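(* Let $G=\langle X;R\rangle$ be a group in $\mathcal{BDG}$ (respectively $\mathcal{PG}$) and let $S$ be a subgroup of $G$ of finite index. Suppose that $\varphi\colon G\to G$ is an automorphism of finite order such that $\varphi(S)=S$. Then the HNN-extension $$H=\langle G,t;\ tst^{-1}=\varphi(s),\ s\in S\rangle$$ is again in $\mathcal{BDG}$ (respectively $\mathcal{PG}$).
   Context: For a group $G=\langle X;R\rangle$ with $X$ finite, let $\Sigma=X\cup X^{-1}$; the word problem of $G$ relative to this presentation is the language $\mathrm{WP}(G:X;R)=\{w\in\Sigma^*: w=1\text{ in }G\}$. $\mathcal{BDC}$ denotes the Boolean closure of the class of deterministic context-free languages: a language over a finite alphabet $\Sigma$ is in $\mathcal{BDC}$ if it belongs to the smallest family of subsets of $\Sigma^*$ containing the deterministic context-free languages over $\Sigma$ and closed under finite union, finite intersection and complement. $\mathcal{PCF}$ denotes the class of poly-context-free languages, i.e. intersections of finitely many context-free languages over the same alphabet. $\mathcal{BDG}$ (respectively $\mathcal{PG}$) is the class of finitely generated groups whose word problem is in $\mathcal{BDC}$ (respectively $\mathcal{PCF}$); this does not depend on the choice of presentation with finite generating set. *)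

(* Defs.v *)
From HB Require Import structures.
From mathcomp Require Import all_boot.
From mathcomp Require Import boolp classical_sets cardinality.
From Stdlib Require Import Relation_Operators.

Set Implicit Arguments.
Unset Strict Implicit.
Unset Printing Implicit Defensive.

Local Open Scope classical_set_scope.
Local Open Scope quotient_scope.
Local Open Scope group_scope.

Definition language (T : finType) := set (seq T).

Record cfg (T : finType) := Cfg {
  cfg_var : finType;
  cfg_start : cfg_var;
  cfg_prods : seq (cfg_var * seq (cfg_var + T))
}.

Inductive cfg_step (T : finType) (M : cfg T) :
    seq (cfg_var M + T) -> seq (cfg_var M + T) -> Prop :=
| CfgStep (u : seq (cfg_var M + T)) (A : cfg_var M)
    (r v : seq (cfg_var M + T)) of (A, r) \in cfg_prods M :
    cfg_step (u ++ inl A :: v) (u ++ r ++ v).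

Definition cfg_language (T : finType) (M : cfg T) : language T :=
  [set w | clos_refl_trans _ (@cfg_step T M)
             [:: inl (cfg_start M)] [seq inr a | a <- w]].

Definition context_free (T : finType) (L : language T) : Prop :=
  exists M : cfg T, L = cfg_language M.

(* In [dpda_trans q o Z], [o = None] is an epsilon-move and [Z] is the top    *)
(* stack symbol, replaced by the returned string (whose head is the new top). *)
(* There is no move from an empty stack.                                      *)
Record dpda (T : finType) := Dpda {
  dpda_state : finType;
  dpda_stack : finType;
  dpda_init : dpda_state;
  dpda_bottom : dpda_stack;
  dpda_final : {set dpda_state};
  dpda_trans : dpda_state -> option T -> dpda_stack ->
    option (dpda_state * seq dpda_stack);
  dpda_det : forall q Z, dpda_trans q None Z != None ->
    forall a, dpda_trans q (Some a) Z = None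
}.

(* A configuration is (state, unread input, stack with its top first). *)
Definition dpda_config (T : finType) (M : dpda T) : Type :=
  dpda_state M * seq T * seq (dpda_stack M).

Inductive dpda_step (T : finType) (M : dpda T) :
    dpda_config M -> dpda_config M -> Prop :=
| DpdaRead q a w Z s p r of dpda_trans q (Some a) Z = Some (p, r) :
    dpda_step (q, a :: w, Z :: s) (p, w, r ++ s)
| DpdaEps q w Z s p r of dpda_trans q None Z = Some (p, r) :
    dpda_step (q, w, Z :: s) (p, w, r ++ s).

(* Acceptance is by final state once the whole input has been read. *)
Definition dpda_language (T : finType) (M : dpda T) : language T :=
  [set w | exists f s, f \in dpda_final M /\
     clos_refl_trans _ (@dpda_step T M)
       (dpda_init M, w, [:: dpda_bottom M]) (f, [::], s)].

Definition det_context_free (T : finType) (L : language T) : Prop :=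
  exists M : dpda T, L = dpda_language M.

Inductive BDC (T : finType) : language T -> Prop :=
| BDC_dcf L of det_context_free L : BDC L
| BDC_union L K of BDC L & BDC K : BDC (L `|` K)
| BDC_inter L K of BDC L & BDC K : BDC (L `&` K)
| BDC_compl L of BDC L : BDC (~` L).

Definition PCF (T : finType) (L : language T) : Prop :=
  exists (n : nat) (K : 'I_n -> language T),
    (forall i, context_free (K i)) /\ L = \bigcap_(i in setT) K i.

(* The letter [(x, false)] stands for x and [(x, true)] for x^-1. *)
Definition word (X : Type) := seq (X * bool).

Definition word_inv (X : Type) (w : word X) : word X :=
  rev [seq (a.1, ~~ a.2) | a <- w].

Inductive pres_eq (X : Type) (R : set (word X)) : word X -> word X -> Prop :=
| pres_refl w : pres_eq R w w
| pres_sym v w of pres_eq R v w : pres_eq R w v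
| pres_trans u v w of pres_eq R u v & pres_eq R v w : pres_eq R u w
| pres_cancel u x b v : pres_eq R (u ++ [:: (x, b); (x, ~~ b)] ++ v) (u ++ v)
| pres_rel u r v of R r : pres_eq R (u ++ r ++ v) (u ++ v).

Section PresentedGroup.
Variables (X : choiceType) (R : set (word X)).
Implicit Types u v w : word X.

Definition pres_eqb : rel (seq (X * bool)) :=
  fun v w => `[< pres_eq R v w >].

Lemma pres_eqb_refl : reflexive pres_eqb.
Proof. by move=> w; apply/asboolP; exact: pres_refl. Qed.

Lemma pres_eqb_sym : symmetric pres_eqb.
Proof. by move=> v w; apply/asboolP/asboolP; exact: pres_sym. Qed.

Lemma pres_eqb_trans : transitive pres_eqb.
Proof.
move=> v u w /asboolP uv /asboolP vw; apply/asboolP; exact: pres_trans uv vw.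
Qed.

Canonical pres_equiv :=
  EquivRel pres_eqb pres_eqb_refl pres_eqb_sym pres_eqb_trans.

Definition presented := {eq_quot pres_equiv}.
HB.instance Definition _ : EqQuotient _ pres_equiv presented :=
  EqQuotient.on presented.
HB.instance Definition _ := Choice.on presented.

Lemma presentedP v w :
  (\pi_presented v = \pi_presented w) <-> pres_eq R v w.
Proof.
by split=> [/eqquotP/asboolP | vw] //; apply/eqquotP/asboolP.
Qed.

Lemma pres_eq_cat u u' v v' :
  pres_eq R u u' -> pres_eq R v v' -> pres_eq R (u ++ v) (u' ++ v').
Proof.
move=> uu' vv'; apply: (@pres_trans _ _ _ (u' ++ v)).
  elim: uu' => {u u' vv'} [w | u w _ | u w z _ IH _ | u x b w | u r w Rr].
  - exact: pres_refl.
  - exact: pres_sym.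
  - exact: pres_trans.
  - by rewrite -!catA; exact: pres_cancel.
  - by rewrite -!catA; exact: pres_rel.
elim: vv' => {u v v' uu'} [w | u w _ | u w z _ IH _ | u x b w | u r w Rr].
- exact: pres_refl.
- exact: pres_sym.
- exact: pres_trans.
- by rewrite !(catA u'); exact: pres_cancel.
- by rewrite !(catA u'); exact: pres_rel.
Qed.

Lemma word_invK : involutive (@word_inv X).
Proof.
move=> w; rewrite /word_inv map_rev revK -map_comp -[RHS]map_id.
by apply: eq_map => -[x b] /=; rewrite negbK.
Qed.

Lemma pres_eq_mulV w : pres_eq R (w ++ word_inv w) [::].
Proof.
elim: w => [|[x b] w IH]; first exact: pres_refl.
have -> : word_inv ((x, b) :: w) = word_inv w ++ [:: (x, ~~ b)].
  by rewrite /word_inv /= rev_cons -cats1.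
rewrite -cat1s -catA (catA w); apply: (pres_trans (v := [:: (x, b)] ++ [::] ++ [:: (x, ~~ b)])).
  apply: pres_eq_cat; first exact: pres_refl.
  by apply: pres_eq_cat IH _; exact: pres_refl.
exact: (pres_cancel R [::] x b [::]).
Qed.

Lemma pres_eq_Vmul w : pres_eq R (word_inv w ++ w) [::].
Proof. by rewrite -{2}[w]word_invK; exact: pres_eq_mulV. Qed.

Definition presented_one : presented := \pi_presented [::].
Definition presented_mul (a b : presented) : presented :=
  \pi_presented (repr a ++ repr b).
Definition presented_inv (a : presented) : presented :=
  \pi_presented (word_inv (repr a)).

Lemma pres_eq_repr w : pres_eq R (repr (\pi_presented w)) w.
Proof. by apply/presentedP; rewrite reprK. Qed.

Lemma presented_mulA : associative presented_mul.
Proof.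
move=> a b c; apply/presentedP.
apply: (pres_trans (v := repr a ++ repr b ++ repr c)).
  apply: pres_eq_cat; [exact: pres_refl | exact: pres_eq_repr].
rewrite catA; apply/pres_sym/pres_eq_cat; last exact: pres_refl.
exact: pres_eq_repr.
Qed.

Lemma presented_mul1g : left_id presented_one presented_mul.
Proof.
move=> a; rewrite -[RHS]reprK; apply/presentedP.
by rewrite -[X in pres_eq R _ X]cat0s; apply: pres_eq_cat;
  [exact: pres_eq_repr | exact: pres_refl].
Qed.

Lemma presented_mulg1 : right_id presented_one presented_mul.
Proof.
move=> a; rewrite -[RHS]reprK; apply/presentedP.
by rewrite -[X in pres_eq R _ X]cats0; apply: pres_eq_cat;
  [exact: pres_refl | exact: pres_eq_repr].
Qed.

Lemma presented_mulVg : left_inverse presented_one presented_inv presented_mul.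
Proof.
move=> a; apply/presentedP; apply: pres_trans (pres_eq_Vmul (repr a)).
by apply: pres_eq_cat; [exact: pres_eq_repr | exact: pres_refl].
Qed.

Lemma presented_mulgV : right_inverse presented_one presented_inv presented_mul.
Proof.
move=> a; apply/presentedP; apply: pres_trans (pres_eq_mulV (repr a)).
by apply: pres_eq_cat; [exact: pres_refl | exact: pres_eq_repr].
Qed.

HB.instance Definition _ := isGroup.Build presented presented_mulA
  presented_mul1g presented_mulg1 presented_mulVg presented_mulgV.

End PresentedGroup.

Definition word_problem (X : finType) (R : set (word X)) :
    language (X * bool)%type :=
  [set w | \pi_(presented R) w = 1].

Definition isomorphic (G H : groupType) : Prop :=
  exists f : {multiplicative G -> H}, bijective f.

(* Membership of the word problem in BDC or PCF does not depend on the finite *)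
(* generating set, so the presentation is quantified existentially.           *)
Definition fg_group_with_WP (C : forall T : finType, language T -> Prop)
    (G : groupType) : Prop :=
  exists (X : finType) (R : set (word X)),
    isomorphic G (presented R) /\ C _ (word_problem R).

Definition BDG (G : groupType) : Prop := fg_group_with_WP BDC G.
Definition PG (G : groupType) : Prop := fg_group_with_WP PCF G.

Definition finite_index (G : groupType) (S : set G) : Prop :=
  finite_set (range (fun g : G => [set g * s | s in S])).

Definition finite_order (T : Type) (f : T -> T) : Prop :=
  exists n : nat, (0 < n)%N /\ iter n f =1 id.

(* The generators of the HNN-extension are the elements [Some g] of G and the *)
(* stable letter [None]; the first set of relators is the multiplication      *)
(* table of G and the second one is t s t^-1 = phi(s) for s in S.             *)
Definition hnn_relators (G : groupType) (S : set G) (phi : G -> G) :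
    set (word (option G)) :=
  [set w | exists g h : G,
     w = [:: (Some g, false); (Some h, false); (Some (g * h), true)]] `|`
  [set w | exists2 s, S s &
     w = [:: (None, false); (Some s, false); (None, true);
             (Some (phi s), true)]].

Definition HNN (G : groupType) (S : set G) (phi : G -> G) : groupType :=
  presented (hnn_relators S phi).

(* Main.v *)
(* Let N be the core of S in G: a normal subgroup of G of finite index which is
   invariant under phi, hence normal in the HNN-extension H.  If phi has order n,
   sending t to a generator of Z/n defines a homomorphism from H to the
   semidirect product of G by Z/n whose restriction to G is injective.  So an
   element of H is trivial iff it belongs to N and has trivial image in this
   semidirect product.
   The second condition is the inverse image of the word problem of G under a
   sequential transducer with set of states Z/n, and both classes are closed
   under inverse images of this kind.  The first one is the word problem of the
   HNN-extension H/N of the finite group G/N: by the normal form theorem, it is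
   decided by a deterministic pushdown automaton whose stack holds a normal form,
   and generated by a grammar undoing pinches t^b s t^-b. *)
Require Import Defs.
From HB Require Import structures.
From mathcomp Require Import all_boot.
From mathcomp Require Import boolp classical_sets cardinality.
From Stdlib Require Import Relation_Operators Operators_Properties.

Set Implicit Arguments.
Unset Strict Implicit.
Unset Printing Implicit Defensive.

Local Open Scope classical_set_scope.

(** * Context-free grammars and letter transducers *)

(** Parse forests over a sentential form: unlike step sequences, they split along concatenations and
    support structural induction. *)
Inductive yields (T : finType) (M : cfg T) :
    seq (cfg_var M + T) -> seq T -> Prop :=
| yields_nil : yields [::] [::]
| yields_letter a r w of yields r w : yields (inr a :: r) (a :: w)
| yields_var A body r u v of (A, body) \in cfg_prods M &
    yields body u & yields r v : yields (inl A :: r) (u ++ v).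

Section Yields.
Variables (T : finType) (M : cfg T).
Implicit Types (r s : seq (cfg_var M + T)) (w : seq T).

Lemma yields_cat r s u v : yields r u -> yields s v -> yields (r ++ s) (u ++ v).
Proof.
move=> ru sv; elim: ru => {r u} [|a r w _ IH|A body r u w inM bu _ rw IH] //=.
  exact: yields_letter.
by rewrite -catA; apply: yields_var inM bu IH.
Qed.

Lemma yields_catP r s w :
  yields (r ++ s) w -> exists u v, [/\ w = u ++ v, yields r u & yields s v].
Proof.
elim: r w => [|X r IH] w /=; first by exists [::], w; split=> //; constructor.
move=> H; inversion H as [|a r' w' rw|A body r' u v inM bu rv]; subst.
  have [u [v [-> ru sv]]] := IH _ rw.
  by exists (a :: u), v; split=> //; constructor.
have [u1 [v1 [-> ru sv]]] := IH _ rv.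
by exists (u ++ u1), v1; split; [rewrite catA|apply: yields_var inM bu ru|].
Qed.

Lemma yields_letters w : @yields _ M [seq inr a | a <- w] w.
Proof. by elim: w => [|a w IH]; constructor. Qed.

Lemma yields1 A body w :
  (A, body) \in cfg_prods M -> yields body w -> yields [:: inl A] w.
Proof.
by move=> inM bw; rewrite -[w]cats0; apply: yields_var inM bw (yields_nil M).
Qed.

Lemma yields1P A w : yields [:: inl A] w ->
  exists2 body, (A, body) \in cfg_prods M & yields body w.
Proof.
move=> H; inversion H as [| |A' body r u v inM bu rv]; subst.
by exists body => //; inversion rv; rewrite cats0.
Qed.

Lemma cfg_step_yields r s w : cfg_step r s -> yields s w -> yields r w.
Proof.
case=> u A body v inM /yields_catP[w1 [w2 [-> uw1 /yields_catP]]].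
move=> [w3 [w4 [-> bw3 vw4]]].
by apply: yields_cat => //; apply: yields_var inM bw3 vw4.
Qed.

Lemma derives_ctx p q r s : clos_refl_trans _ (@cfg_step T M) r s ->
  clos_refl_trans _ (@cfg_step T M) (p ++ r ++ q) (p ++ s ++ q).
Proof.
elim=> {r s} [r s [u A body v inM]|r|r s t _ IH1 _ IH2].
- rewrite -!catA /= !(catA p); apply: rt_step; exact: CfgStep.
- exact: rt_refl.
- exact: rt_trans IH1 IH2.
Qed.

Lemma yields_derives r w : yields r w ->
  clos_refl_trans _ (@cfg_step T M) r [seq inr a | a <- w].
Proof.
elim=> {r w} [|a r w _ IH|A body r u v inM _ IHu _ IHv] /=.
- exact: rt_refl.
- by have := derives_ctx [:: inr a] [::] IH; rewrite !cats0.
- apply: (@rt_trans _ _ _ (body ++ r)).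
    by apply: rt_step; exact: (CfgStep [::] r inM).
  apply: (@rt_trans _ _ _ ([seq inr a | a <- u] ++ r)).
    exact: (derives_ctx [::] r IHu).
  rewrite map_cat; have := derives_ctx [seq inr a | a <- u] [::] IHv.
  by rewrite !cats0.
Qed.

Lemma cfg_languageP w : cfg_language M w <-> yields [:: inl (cfg_start M)] w.
Proof.
split=> [|/yields_derives//]; rewrite /cfg_language /=.
(* The terminal word yields itself, and this is pulled back step by step from the end of the
   derivation. *)
have := yields_letters w; move: (map _ w) => x xw rtx.
have := clos_rt_rt1n _ _ _ _ rtx => {rtx} D.
elim: D xw => // {}x y z xy _ IH /IH; exact: cfg_step_yields.
Qed.

End Yields.

(* An edge out of [p] along which the letter [a] of the source word is
   consumed carries a pair [(o, p')]: the letter emitted, if any, and the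
   target. *)
Section Transducer.
Variables (T T' P : finType) (edges : P -> T -> seq (option T' * P)).

Inductive transduces : P -> seq T' -> seq T -> P -> Prop :=
| transduces_nil p : transduces p [::] [::] p
| transduces_cons p a o p' w y q of
    (o, p') \in edges p a & transduces p' w y q :
    transduces p (seq_of_opt o ++ w) (a :: y) q.

Lemma transduces_cat p w y p' w' y' q :
  transduces p w y p' -> transduces p' w' y' q ->
  transduces p (w ++ w') (y ++ y') q.
Proof.
elim=> {p w y p'} [//|p a o p' w y p'' inE _ IH] /IH H.
by rewrite -catA; apply: transduces_cons inE H.
Qed.

Lemma transduces_catP p w y y' q : transduces p w (y ++ y') q ->
  exists w1 w2 p', [/\ w = w1 ++ w2, transduces p w1 y p' &
    transduces p' w2 y' q].
Proof.
elim: y p w => [|a y IH] p w /=.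
  by exists [::], w, p; split=> //; constructor.
move=> H; inversion H as [|? ? o p' w' ? ? inE H']; subst.
have [w1 [w2 [p'' [-> H1 H2]]]] := IH _ _ H'.
exists (seq_of_opt o ++ w1), w2, p''; split=> //; first by rewrite catA.
exact: transduces_cons inE H1.
Qed.

Variables (M : cfg T) (p0 : P) (F : pred P).
Local Notation var := (option (P * cfg_var M * P)).

Definition emit (o : option T') : seq (var + T') :=
  [seq inr a | a <- seq_of_opt o].

(** All ways of threading a walk from [p] through [r], each listed with its end state; the state
    after a variable is guessed. *)
Fixpoint bodies (p : P) (r : seq (cfg_var M + T)) :
    seq (P * seq (var + T')) :=
  match r with
  | [::] => [:: (p, [::])]
  | inl A :: r => [seq (qu.1, inl (Some (p, A, p')) :: qu.2)
                    | p' <- enum P, qu <- bodies p' r]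
  | inr a :: r => [seq (qu.1, emit e.1 ++ qu.2)
                    | e <- edges p a, qu <- bodies e.2 r]
  end.

(* The variable [Some (p, A, q)] generates the words emitted along a walk from
   [p] to [q] consuming a word generated by [A]. *)
Definition transduction_cfg : cfg T' := @Cfg T' var None
  ([seq (None, [:: inl (Some (p0, cfg_start M, q))]) | q <- enum F] ++
   [seq (Some (pA.1, pA.2.1, qu.1), qu.2)
     | pA <- [seq (p, A) | p <- enum P, A <- cfg_prods M],
       qu <- bodies pA.1 pA.2.2]).
Local Notation N := transduction_cfg.

Lemma prods_SomeP p A q u : (Some (p, A, q), u) \in cfg_prods N <->
  exists2 body, (A, body) \in cfg_prods M & (q, u) \in bodies p body.
Proof.
split.
  rewrite mem_cat => /orP[/mapP[? _ //]|].
  case/allpairsPdep=> -[p1 [A1 body]] [[q1 u1]] [].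
  case/allpairsP=> -[p2 Ab] /= [_ inM [_ E]] inB [-> -> -> ->].
  by exists body => //; rewrite E.
case=> body inM inB; rewrite mem_cat; apply/orP; right.
apply/allpairsPdep; exists (p, (A, body)), (q, u); split=> //.
by apply/allpairsP; exists (p, (A, body)); rewrite mem_enum.
Qed.

Lemma prods_None u : (None, u) \in cfg_prods N ->
  exists2 q, F q & u = [:: inl (Some (p0, cfg_start M, q))].
Proof.
rewrite mem_cat => /orP[/mapP[q qF [->]]|].
  by exists q => //; rewrite mem_enum in qF.
by case/allpairsPdep=> ? [? []].
Qed.

(** Quantified over all [r], since [u] does not determine the body it comes from: a letter consumed
    without emission leaves no trace. *)
Definition lifts (u : seq (var + T')) (w : seq T') : Prop :=
  forall r p q, (q, u) \in bodies p r ->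
  exists2 y, yields r y & transduces p w y q.

(** The induction on [r] passes over the letters that emit nothing, until the symbol of [r]
    responsible for the head of [u] is reached. *)
Lemma lifts_step u w :
  match u with
  | [::] => w = [::]
  | inr b :: u => exists2 w', w = b :: w' & lifts u w'
  | inl (Some (p, A, q)) :: u => exists w1 w2, [/\ w = w1 ++ w2,
      exists2 y, @yields _ M [:: inl A] y & transduces p w1 y q & lifts u w2]
  | inl None :: _ => True
  end -> lifts u w.
Proof.
move=> H; elim=> [|[A|a] r IH] p q /=.
- rewrite inE => /eqP[-> uE]; rewrite uE in H *; rewrite H.
  by exists [::]; constructor.
- case/allpairsPdep=> p' [[q' u']] [_ inB /= [-> uE]]; subst u.
  have [w1 [w2 [-> [y1 Ay1 py1] /(_ _ _ _ inB)[y2 ry2 py2]]]] := H.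
  exists (y1 ++ y2); first exact: (yields_cat Ay1 ry2).
  exact: transduces_cat py1 py2.
- case/allpairsPdep=> -[[b|] p'] [[q' u']] [inE inB /= [-> uE]]; subst u.
    have [w' -> /(_ _ _ _ inB)[y ry py]] := H.
    by exists (a :: y); [constructor|exact: transduces_cons inE py].
  have [y ry py] := IH _ _ inB.
  by exists (a :: y); [constructor|exact: transduces_cons inE py].
Qed.

Lemma yields_lifts u w : @yields _ N u w -> lifts u w.
Proof.
elim=> {u w} [|a u w _ IH|[[[p A] q]|] u v w1 w2 inN _ IHu _ IHv];
  apply: lifts_step => //.
- by exists w.
- exists w1, w2; split=> //.
  have [body inM /IHu[y by_ py]] := (prods_SomeP _ _ _ _).1 inN.
  by exists y => //; exact: yields1 inM by_.
Qed.

Lemma yields_emit o u w :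
  @yields _ N u w -> @yields _ N (emit o ++ u) (seq_of_opt o ++ w).
Proof. by case: o => //= a H; constructor. Qed.

Lemma yields_bodies r y p w q : @yields _ M r y -> transduces p w y q ->
  exists2 u, (q, u) \in bodies p r & @yields _ N u w.
Proof.
move=> H; elim: H p w q => {r y} [|a r y _ IH|A body r y1 y2 inM _ IHb _ IHr].
- move=> p w q H; inversion H; subst; exists [::]; last exact: yields_nil.
  by rewrite /= inE.
- move=> p w q H; inversion H as [|? ? o p' w' ? ? inE H']; subst.
  have [u inB uw] := IH _ _ _ H'.
  exists (emit o ++ u); last exact: yields_emit.
  by apply/allpairsPdep; exists (o, p'), (q, u).
- move=> p w q /transduces_catP[w1 [w2 [p' [-> /IHb[u1 in1 uw1]]]]].
  case/IHr=> u2 in2 uw2; exists (inl (Some (p, A, p')) :: u2).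
    by apply/allpairsPdep; exists p', (q, u2); rewrite mem_enum.
  by apply: yields_var uw1 uw2; apply/prods_SomeP; exists body.
Qed.

Lemma transduction_cfgP w : cfg_language N w <->
  exists y q, [/\ cfg_language M y, F q & transduces p0 w y q].
Proof.
split=> [/cfg_languageP/yields1P[u /prods_None[q Fq ->]]|].
  case/yields1P=> v /prods_SomeP[body inM inB] /yields_lifts/(_ _ _ _ inB).
  case=> y by_ py; exists y, q; split=> //.
  by apply/cfg_languageP/yields1/by_.
case=> y [q [/cfg_languageP/yields1P[body inM by_] Fq py]].
have [u inB uw] := yields_bodies by_ py.
apply/cfg_languageP.
apply: (@yields1 _ N _ [:: inl (Some (p0, cfg_start M, q))]).
  by rewrite mem_cat map_f ?mem_enum.
by apply: yields1 uw; apply/prods_SomeP; exists body.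
Qed.

End Transducer.

Arguments transduces {T T' P} edges.

Lemma context_free_transduction (T T' P : finType)
    (edges : P -> T -> seq (option T' * P)) (p0 : P) (F : pred P)
    (L : language T) : context_free L ->
  context_free [set w | exists y q, [/\ L y, F q & transduces edges p0 w y q]].
Proof.
case=> M ->; exists (transduction_cfg edges M p0 F).
by apply/seteqP; split=> w /transduction_cfgP.
Qed.

(** * Inverse images under sequential maps *)

Section SequentialMap.
Variables (T T' K : finType) (delta : K -> T' -> K) (out : K -> T' -> seq T).

(** The map computed by a generalized sequential machine, which outputs a word for each letter. *)
Fixpoint gsm (k : K) (w : seq T') : seq T :=
  if w is x :: w then out k x ++ gsm (delta k x) w else [::].

Definition gsm_bound := \max_(kx : K * T') size (out kx.1 kx.2).
Local Notation buffer := (gsm_bound.-bseq T).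

Lemma size_out k x : size (out k x) <= gsm_bound.
Proof. exact: (leq_bigmax (F := fun kx => size (out kx.1 kx.2)) (k, x)). Qed.

Lemma insub_bseqK (n : nat) (s : seq T) : size s <= n ->
  insub_bseq n s = s :> seq T.
Proof. by move=> sn; rewrite /insub_bseq insubdK. Qed.

(* With nonempty outputs, every letter is read together with the first letter
   of its image; in particular the deterministic automaton below never has to
   choose between an empty move of [M] and reading ahead. *)
Hypothesis out_neq0 : forall k x, out k x != [::].

(** The inverse machine. The buffer holds the rest of the image of the letter last emitted; when it
    is empty, the next letter is guessed among those whose image starts with [a]. *)
Definition gsm_edges (p : K * buffer) (a : T) :
    seq (option T' * (K * buffer)) :=
  match val p.2 with
  | [::] => [seq (Some x, (delta p.1 x, insub_bseq _ (behead (out p.1 x))))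
              | x <- enum T' & ohead (out p.1 x) == Some a]
  | c :: b => if c == a then [:: (None, (p.1, insub_bseq _ b))] else [::]
  end.

Lemma gsm_edgesP k w y : (exists2 q : K * buffer, nilp q.2 &
    transduces gsm_edges (k, [bseq]) w y q) <-> y = gsm k w.
Proof.
(* For the induction, the walk may start with an arbitrary buffer, which is then consumed first. *)
suff: forall b : buffer, (exists2 q : K * buffer, nilp q.2 &
    transduces gsm_edges (k, b) w y q) <-> y = b ++ gsm k w.
  by move/(_ [bseq]).
move=> b; split.
  case=> q qnil H; move: {-2}(k, b) H (erefl (k, b)) => p H.
  elim: H k b qnil => {p w y q} [p|p a o p' w y q inE _ IH] k b qnil pE.
    by move: qnil; rewrite -{1}pE /= => /nilP->.
  move: inE; rewrite -{}pE /gsm_edges /=; case: b => -[|c b] sb /=.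
    case/mapP=> x; rewrite mem_filter => /andP[hx _] [-> p'E].
    rewrite (IH _ _ qnil (esym p'E)) /= insub_bseqK; last first.
      by rewrite size_behead (leq_trans (leq_pred _)) ?size_out.
    by case: (out k x) hx => //= c s /eqP[->].
  case: eqP => // ->; rewrite inE => /eqP[-> p'E].
  by rewrite (IH _ _ qnil (esym p'E)) /= insub_bseqK // ltnW.
move=> ->; elim: w k b {y} => [|x w IHw] k b; case: b => s;
  elim: s => [|c s IHs] sb /=.
- exists (k, [bseq]) => //; rewrite (_ : Bseq sb = [bseq]); last exact: val_inj.
  exact: transduces_nil.
- have s_le : size s <= gsm_bound by rewrite ltnW.
  have [q qnil H] := IHs s_le; exists q => //.
  rewrite -[[::]]/(seq_of_opt None ++ [::]); apply: transduces_cons H.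
  rewrite /gsm_edges /= eqxx inE; apply/eqP; congr (_, (_, _)).
  by apply: val_inj; rewrite /= insub_bseqK.
- have [c [s outE]] : exists c s, out k x = c :: s.
    by case: (out k x) (out_neq0 k x) => // c s _; exists c, s.
  have s_le : size s <= gsm_bound.
    by rewrite ltnW // -[_.+1]/(size (c :: s)) -outE size_out.
  have [q qnil] := IHw (delta k x) (insub_bseq _ s).
  rewrite insub_bseqK // => H; exists q => //; rewrite outE /=.
  rewrite -[x :: w]/(seq_of_opt (Some x) ++ w); apply: transduces_cons H.
  rewrite /gsm_edges /=; apply/mapP; exists x; last by rewrite outE.
  by rewrite mem_filter mem_enum outE /= eqxx.
- have s_le : size s <= gsm_bound by rewrite ltnW.
  have [q qnil H] := IHs s_le; exists q => //.
  rewrite -[x :: w]/(seq_of_opt None ++ (x :: w)); apply: transduces_cons H.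
  rewrite /gsm_edges /= eqxx inE; apply/eqP; congr (_, (_, _)).
  by apply: val_inj; rewrite /= insub_bseqK.
Qed.

Lemma context_free_gsm (k : K) (L : language T) :
  context_free L -> context_free [set w | L (gsm k w)].
Proof.
move=> /(context_free_transduction gsm_edges (k, [bseq]) (fun q => nilp q.2)).
congr context_free; apply/seteqP; split=> w /=.
  case=> y [q [Ly qnil H]].
  by have <- : y = gsm k w by apply/gsm_edgesP; exists q.
move=> Lw; have [q qnil H] := (gsm_edgesP k w _).2 erefl.
by exists (gsm k w), q.
Qed.

(** * Inverse images of deterministic context-free languages *)

Section DeterministicAutomaton.
Variables (M : dpda T) (k0 : K).
Local Notation state := (dpda_state M * (K * buffer))%type.
Local Notation stack := (dpda_stack M).

Definition with_buffer (k : K) (b : seq T)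
    (m : option (dpda_state M * seq stack)) :
    option (state * seq stack) :=
  omap (fun pr => ((pr.1, (k, insub_bseq _ b)), pr.2)) m.

Definition gsm_trans (p : state) (o : option T') (Z : stack) :
    option (state * seq stack) :=
  let: (q, (k, b)) := p in
  match dpda_trans q None Z, o, val b with
  | Some pr, None, _ => Some ((pr.1, (k, b)), pr.2)
  | None, None, a :: b => with_buffer k b (dpda_trans q (Some a) Z)
  | None, Some x, [::] => if out k x is a :: b then
       with_buffer (delta k x) b (dpda_trans q (Some a) Z) else None
  | _, _, _ => None
  end.

Lemma gsm_trans_det p Z : gsm_trans p None Z != None ->
  forall x, gsm_trans p (Some x) Z = None.
Proof.
case: p => q [k b] /=; case: (dpda_trans q None Z) => // H x.
by case: (val b) H.
Qed.

(** Acceptance requires an empty buffer, as [M] must have read the whole image. *)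
Definition gsm_dpda : dpda T' := @Dpda T' state stack
  (dpda_init M, (k0, [bseq])) (dpda_bottom M)
  [set p : state | (p.1 \in dpda_final M) && nilp p.2.2]%SET
  gsm_trans gsm_trans_det.

(** Under this map the steps of the two automata correspond one to one, in both directions. *)
Definition unbuffer (c : dpda_config gsm_dpda) : dpda_config M :=
  let: (q, (k, b), w, s) := c in (q, b ++ gsm k w, s).

Lemma gsm_dpda_step c c' :
  dpda_step c c' -> dpda_step (unbuffer c) (unbuffer c').
Proof.
case=> [[q [k b]] x w Z s p r /=|[q [k b]] w Z s p r /=].
  case: dpda_trans => //; case: b => -[|//] /= _.
  case outE: (out k x) => [//|a b] /=.
  case E: dpda_trans => [[p' r']|] //= [<- <-] /=.
  rewrite insub_bseqK; first exact: DpdaRead.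
  by have := size_out k x; rewrite outE; exact: ltnW.
case E: dpda_trans => [[p' r']|] /=; first by case=> <- <-; exact: DpdaEps.
case: b => -[//|a b] /= sb.
case E': dpda_trans => [[p' r']|] //= [<- <-] /=.
rewrite insub_bseqK; first exact: DpdaRead.
exact: ltnW.
Qed.

Lemma gsm_dpda_lift c d : dpda_step (unbuffer c) d ->
  exists2 c', dpda_step c c' & unbuffer c' = d.
Proof.
case: c => -[[q [k b]] w] s; rewrite /unbuffer => H.
inversion H as [q' a y Z s' p r E|q' y Z s' p r E]; subst; last first.
  exists (p, (k, b), w, r ++ s') => //; apply: DpdaEps.
  by rewrite /= E.
(* Since [M] reads [a] here, its determinism excludes an empty move, which [gsm_trans] would have
   preferred. *)
have Eeps : dpda_trans q None Z = None.
  by apply/eqP/negP => /negP/dpda_det/(_ a); rewrite E.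
case: b H1 H => -[|c b] sb /=; last first.
  case=> ? ? H; subst; exists (p, (k, insub_bseq _ b), w, r ++ s') => /=.
    by apply: DpdaEps; rewrite /= Eeps E.
  by rewrite insub_bseqK // ltnW.
case: w => [//|x w] /=; case outE: (out k x) (out_neq0 k x) => [//|c b] _ /=.
case=> ? ? H; subst.
exists (p, (delta k x, insub_bseq _ b), w, r ++ s') => /=.
  by apply: DpdaRead; rewrite /= Eeps outE E.
by rewrite insub_bseqK // ltnW //; have := size_out k x; rewrite outE.
Qed.

Lemma gsm_dpda_run c c' :
  clos_refl_trans _ (@dpda_step _ gsm_dpda) c c' ->
  clos_refl_trans _ (@dpda_step _ M) (unbuffer c) (unbuffer c').
Proof.
elim=> {c c'} [c c' /gsm_dpda_step|c|c d e _ IH _ IH'].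
- exact: rt_step.
- exact: rt_refl.
- exact: rt_trans IH IH'.
Qed.

Lemma gsm_dpda_lift_run c d :
  clos_refl_trans _ (@dpda_step _ M) (unbuffer c) d ->
  exists2 c', clos_refl_trans _ (@dpda_step _ gsm_dpda) c c' & unbuffer c' = d.
Proof.
move=> H; have [d0 d0E] : exists d0, d0 = unbuffer c by exists (unbuffer c).
rewrite -d0E in H.
elim: H c d0E => {d0 d} [d d' + |d|d d' e _ IH _ IH'] c cE.
- rewrite cE => /gsm_dpda_lift[c' cc' c'E].
  by exists c' => //; exact: rt_step.
- by exists c; [exact: rt_refl|].
- have [c1 c01 c1E] := IH c cE; have [c2 c12 c2E] := IH' c1 (esym c1E).
  by exists c2 => //; exact: rt_trans c01 c12.
Qed.

Lemma gsm_dpdaP w : dpda_language gsm_dpda w <-> dpda_language M (gsm k0 w).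
Proof.
split.
  case=> -[f [k b]] [s []]; rewrite inE /= => /andP[fF /nilP bE].
  by move/gsm_dpda_run; rewrite /= bE; exists f, s.
case=> f [s [fF H]].
pose c0 : dpda_config gsm_dpda :=
  (dpda_init gsm_dpda, w, [:: dpda_bottom gsm_dpda]).
have [] := @gsm_dpda_lift_run c0 _ H => -[[[q [k b]] w'] s'] c0c [qE bE sE].
(* The unread image is empty; as no output is empty, neither buffer nor input has a letter left. *)
subst q s'; case: b bE c0c => -[|//] sb /=; case: w' => [|x w'] /=; last first.
  by case: (out k x) (out_neq0 k x).
by move=> _ c0c; exists (f, (k, Bseq sb)), s; split=> //; rewrite inE /= fF.
Qed.

End DeterministicAutomaton.

Lemma det_context_free_gsm (k : K) (L : language T) :
  det_context_free L -> det_context_free [set w | L (gsm k w)].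
Proof.
by case=> M ->; exists (gsm_dpda M k); apply/seteqP; split=> w /gsm_dpdaP.
Qed.

(** Inverse images under a function commute with the Boolean operations. *)
Lemma BDC_gsm (k : K) (L : language T) : BDC L -> BDC [set w | L (gsm k w)].
Proof.
elim=> {L} [L /(det_context_free_gsm k)|L L' _ IH _ IH'|L L' _ IH _ IH'|L _ IH].
- exact: BDC_dcf.
- exact: BDC_union IH IH'.
- exact: BDC_inter IH IH'.
- exact: BDC_compl IH.
Qed.

Lemma PCF_gsm (k : K) (L : language T) : PCF L -> PCF [set w | L (gsm k w)].
Proof.
case=> n [C [cfC ->]]; exists n, (fun i => [set w | C i (gsm k w)]).
by split=> // i; exact: context_free_gsm.
Qed.

End SequentialMap.

Lemma context_free_PCF (T : finType) (L : language T) : context_free L -> PCF L.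
Proof.
move=> cfL; exists 1, (fun=> L); split=> //.
by apply/seteqP; split=> w => [Lw i _|/(_ ord0 I)].
Qed.

Lemma PCF_inter (T : finType) (L L' : language T) :
  PCF L -> PCF L' -> PCF (L `&` L').
Proof.
case=> m [C [cfC ->]] [n [D [cfD ->]]].
exists (m + n), (fun i => match split i with inl j => C j | inr j => D j end).
split=> [i|]; first by case: split.
apply/seteqP; split=> w.
  by case=> Cw Dw i _ /=; case: (split i) => j; [exact: Cw|exact: Dw].
move=> H; split=> i _.
  by have := H (lshift n i) I; rewrite -/(unsplit (inl i)) unsplitK.
by have := H (rshift m i) I; rewrite -/(unsplit (inr i)) unsplitK.
Qed.

Local Open Scope quotient_scope.
Local Open Scope group_scope.

(** * Values of words in groups *)

Definition letter_val (X : Type) (G : groupType) (f : X -> G) (a : X * bool) :=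
  if a.2 then (f a.1)^-1 else f a.1.

Definition word_val (X : Type) (G : groupType) (f : X -> G) (w : word X) : G :=
  \prod_(a <- w) letter_val f a.

Section WordValue.
Variables (X : Type) (G : groupType) (f : X -> G).

Lemma word_val_nil : word_val f [::] = 1. Proof. exact: big_nil. Qed.

Lemma word_val_cons a w : word_val f (a :: w) = letter_val f a * word_val f w.
Proof. exact: big_cons. Qed.

Lemma word_val_cat v w : word_val f (v ++ w) = word_val f v * word_val f w.
Proof. exact: big_cat. Qed.

Lemma word_val_inv w : word_val f (word_inv w) = (word_val f w)^-1.
Proof.
elim: w => [|[x b] w IH]; first by rewrite /word_inv word_val_nil invg1.
rewrite /word_inv /= rev_cons -cats1 word_val_cat IH !word_val_cons invgM.
by rewrite word_val_nil mulg1 /letter_val; case: b; rewrite //= invgK.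
Qed.

Lemma word_val_pres (R : set (word X)) v w :
  (forall r, R r -> word_val f r = 1) -> pres_eq R v w ->
  word_val f v = word_val f w.
Proof.
move=> f1; elim=> // {v w} [u v w _ -> _ -> //|u x b v|u r v /f1 r1].
  rewrite !word_val_cat !word_val_cons word_val_nil /letter_val mulg1 /=.
  by case: b; rewrite /= ?mulgV ?mulVg mul1g.
by rewrite !word_val_cat r1 mul1g.
Qed.

End WordValue.

Lemma word_val_map (X Y : Type) (G : groupType) (f : Y -> G) (h : X -> Y) w :
  word_val f [seq (h a.1, a.2) | a <- w] = word_val (f \o h) w.
Proof. by rewrite /word_val big_map. Qed.

Section Presented.
Variables (X : choiceType) (R : set (word X)).
Local Notation pi w := (\pi_(presented R) w).

Lemma pi_cat v w : pi (v ++ w) = pi v * pi w.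
Proof.
apply/presentedP/pres_eq_cat; apply/pres_sym; exact: pres_eq_repr.
Qed.

Lemma pi_nil : pi [::] = 1. Proof. by []. Qed.

Lemma pi_invl x b : pi [:: (x, ~~ b)] = (pi [:: (x, b)])^-1.
Proof.
apply: (mulgI (pi [:: (x, b)])); rewrite mulgV -pi_cat.
apply/presentedP; exact: (pres_cancel R [::] x b [::]).
Qed.

Lemma pi_word_val w : pi w = word_val (fun x => pi [:: (x, false)]) w.
Proof.
elim: w => [|[x b] w IH]; first by rewrite word_val_nil.
rewrite word_val_cons -IH -cat1s pi_cat; congr (_ * _).
by case: b; rewrite // (pi_invl x false).
Qed.

Lemma pi_rel r : R r -> word_val (fun x => pi [:: (x, false)]) r = 1.
Proof.
move=> Rr; rewrite -pi_word_val -pi_nil; apply/presentedP.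
by have := pres_rel [::] [::] Rr; rewrite cats0.
Qed.

End Presented.

(** * Presenting a group on given generators by all their trivial words *)

Section PresentationByKernel.
Variables (X : finType) (G : groupType) (f : X -> G).
Hypothesis f_gen : forall g, exists w, word_val f w = g.
Let R := [set w | word_val f w = 1].

Lemma kernel_pres_eq v w : pres_eq R v w <-> word_val f v = word_val f w.
Proof.
split=> [|vw]; first exact: word_val_pres.
(* When [v] and [w] have the same value, [v ++ word_inv w] is itself a relator. *)
apply: (@pres_trans _ _ _ (v ++ word_inv w ++ w)).
  apply/pres_sym; rewrite -{2}[v]cats0; apply: pres_eq_cat (pres_refl _ _) _.
  exact: pres_eq_Vmul.
rewrite catA; apply: (@pres_rel _ R [::] (v ++ word_inv w) w).
by rewrite /R /= word_val_cat word_val_inv vw mulgV.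
Qed.

(** This will present the HNN-extension on a finite alphabet, its defining presentation having all
    of G as generators. *)
Lemma kernel_presentation : isomorphic G (presented R) /\
  word_problem R = [set w | word_val f w = 1].
Proof.
split; last first.
  apply/seteqP; split=> w; rewrite /word_problem /= -pi_nil.
    by move/presentedP/kernel_pres_eq; rewrite word_val_nil.
  by move=> w1; apply/presentedP/kernel_pres_eq; rewrite word_val_nil.
pose wd g := sval (cid (f_gen g)).
have wdK g : word_val f (wd g) = g by rewrite /wd; case: cid.
pose F g := \pi_(presented R) (wd g).
have FM : {morph F : x y / x * y}.
  move=> x y; rewrite /F -pi_cat; apply/presentedP/kernel_pres_eq.
  by rewrite word_val_cat !wdK.
pose FF := isMultiplicative.Build _ _ F FM.
pose Fm : {multiplicative G -> presented R} := HB.pack F FF.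
exists Fm, (fun p => word_val f (repr p)) => [g|p] /=.
  rewrite -[RHS]wdK; apply/kernel_pres_eq; exact: pres_eq_repr.
rewrite -[RHS]reprK; apply/presentedP/kernel_pres_eq; exact: wdK.
Qed.

End PresentationByKernel.

(** Carrying the generators back along the isomorphism allows working in [G] itself, on which [S]
    and [phi] live. *)
Lemma fg_group_generators (C : forall T : finType, language T -> Prop)
    (G : groupType) : fg_group_with_WP C G ->
  exists (X : finType) (f : X -> G),
    (forall g, exists w, word_val f w = g) /\ C _ [set w | word_val f w = 1].
Proof.
case=> X [R [[i [j ij ji]] CR]].
have jM : {morph j : x y / x * y} by exact: (can2_gmulfM ij ji).
have j1 : j 1 = 1 by apply: (mulgI (j 1)); rewrite -jM !mulg1.
have jV : {morph j : x / x^-1}.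
  by move=> x; apply: (mulgI (j x)); rewrite -jM !mulgV.
exists X, (fun x => j (\pi [:: (x, false)])).
have jE w : word_val (fun x => j (\pi_(presented R) [:: (x, false)])) w =
    j (\pi w).
  rewrite pi_word_val; elim: w => [|a w IH]; first by rewrite !word_val_nil j1.
  rewrite !word_val_cons jM IH /letter_val; congr (_ * _).
  by case: ifP => // _; rewrite jV.
split=> [g|].
  by exists (repr (i g)); rewrite jE reprK ij.
rewrite (_ : [set w | _] = word_problem R) //.
apply/seteqP; split=> w; rewrite /word_problem /= jE; last by move->.
by rewrite -j1 => /(can_inj ji).
Qed.

Lemma function_section (T : choiceType) (I : Type) (f : T -> I) (x0 : T) :
  exists r : I -> T, forall x, f (r (f x)) = f x.
Proof.
exists (fun i => xget x0 [set x | f x = i]) => x.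
exact: (@xgetI _ x0 [set y | f y = f x] x erefl).
Qed.

(** * Normal forms in the HNN-extension *)

Definition to_hnn (X : Type) (G : groupType) (gen : X -> G)
  (a : option X * bool) : option G * bool := (omap gen a.1, a.2).

Section NormalForms.
Variables (G : groupType) (S : set G) (phi : {multiplicative G -> G}).
Variable psi : G -> G.
Hypotheses (S_subgroup : group_closed [in S]).
Hypotheses (phiK : cancel phi psi) (psiK : cancel psi phi).
Hypothesis phi_S : (phi @` S)%classic = S.

Lemma subgroup1 : S 1.
Proof. by have [/set_mem] := S_subgroup. Qed.

Lemma subgroupV x : S x -> S x^-1.
Proof.
by move=> /mem_set Sx; apply: set_mem; exact: (group_closedV S_subgroup).
Qed.

Lemma subgroupM x y : S x -> S y -> S (x * y).
Proof.
move=> /mem_set Sx /mem_set Sy; apply: set_mem.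
exact: (group_closedM S_subgroup).
Qed.

Lemma subgroupMr x y : S y -> S (x * y) -> S x.
Proof.
by move=> /subgroupV Sy Sxy; rewrite -[x](mulgK y); exact: subgroupM.
Qed.

(* With [false] standing for t and [true] for t^-1, the HNN-extension satisfies
   t^b s t^-b = twist b s for s in S. *)
Definition twist (b : bool) : G -> G := if b then psi else phi.

Lemma twistM b : {morph twist b : x y / x * y}.
Proof. by case: b => /=; [exact: can2_gmulfM phiK psiK|exact: gmulfM]. Qed.

Lemma twist1 b : twist b 1 = 1.
Proof. by apply: (mulgI (twist b 1)); rewrite -twistM !mulg1. Qed.

Lemma twistV b : {morph twist b : x / x^-1}.
Proof.
by move=> x; apply: (mulgI (twist b x)); rewrite -twistM !mulgV twist1.
Qed.

Lemma twistK b : cancel (twist (~~ b)) (twist b).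
Proof. by case: b. Qed.

Lemma twist_sub b x : S x -> S (twist b x).
Proof.
case: b => /= Sx; last by rewrite -phi_S; exists x.
by move: Sx; rewrite -{1}phi_S => -[y Sy <-]; rewrite phiK.
Qed.

(** * Coset representatives and the finite quotient by the core of S *)

Section FiniteIndex.
Hypothesis S_index : finite_index S.

Lemma coset_index : exists m (idx : G -> 'I_m),
  forall g h, idx g = idx h <-> S (g^-1 * h).
Proof.
have /finite_seqP[s sE] := S_index.
have in_s g : [set g * x | x in S] \in s.
  by have : range (fun g => [set g * x | x in S]) [set g * x | x in S];
    [exists g|rewrite sE].
have lt_s g : (index [set (g * x)%g | x in S] s < size s)%N.
  by rewrite index_mem.
exists (size s), (fun g => Ordinal (lt_s g)) => g h; split=> [[idxE]|Sgh].
  have : [set g * x | x in S] = [set h * x | x in S].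
    by rewrite -(nth_index set0 (in_s g)) idxE nth_index.
  move/seteqP=> [_ /(_ h)][|x Sx <-]; last by rewrite mulKg.
  by exists 1; [exact: subgroup1|rewrite mulg1].
apply: val_inj; congr (index _ s); apply/seteqP; split=> _ [x Sx <-].
  exists ((g^-1 * h)^-1 * x); last by rewrite invgM invgK !mulgA mulgV mul1g.
  by apply: subgroupM => //; exact: subgroupV.
by exists (g^-1 * h * x); [exact: subgroupM|rewrite !mulgA mulgV mul1g].
Qed.

Lemma coset_representatives : exists rep : G -> G,
  (forall g, S ((rep g)^-1 * g)) /\
  (forall g h, S (g^-1 * h) -> rep g = rep h).
Proof.
have [m [idx idxP]] := coset_index.
have [r rK] := function_section idx 1.
by exists (r \o idx); split=> [g|g h /idxP /= -> //]; apply/idxP; exact: rK.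
Qed.

(* The classes are the cosets of the core of [S], recorded as the permutations
   of G/S that they induce by left translation. *)
Lemma finite_quotient : exists (Q : finType) (cls : G -> Q) (sec : Q -> G),
  [/\ forall g, cls (sec (cls g)) = cls g,
      forall g g' h h', cls g = cls g' -> cls h = cls h' ->
        cls (g * h) = cls (g' * h'),
      forall b g h, cls g = cls h -> cls (twist b g) = cls (twist b h) &
      forall g h, cls g = cls h -> S g -> S h].
Proof.
have [m [idx idxP]] := coset_index.
have [r rK] := function_section idx 1.
have idxM g h h' : idx h = idx h' -> idx (g * h) = idx (g * h').
  by move/idxP => Sh; apply/idxP; rewrite invgM -mulgA mulKg.
pose cls g := [ffun i : 'I_m => idx (g * r i)].
have clsP g h : cls g = cls h <-> forall k, idx (g * k) = idx (h * k).
  split=> [/ffunP gh k|gh]; last by apply/ffunP=> i; rewrite !ffunE.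
  have := gh (idx k); rewrite !ffunE.
  by rewrite (idxM g _ k (rK k)) (idxM h _ k (rK k)).
have [sec secK] := function_section cls 1.
exists _, cls, sec; split=> //.
- move=> g g' h h' /clsP gg' /clsP hh'; apply/clsP => k.
  by rewrite -!mulgA gg'; apply: idxM.
- move=> b g h /clsP gh; apply/clsP => k; apply/idxP.
  (* The core is invariant under [twist b]: the action on the coset of [k] is compared with that on
     its preimage, and [twist b] preserves S. *)
  have /idxP/(twist_sub b) := gh (twist (~~ b) k).
  by rewrite twistM twistV !twistM !twistK.
(* Evaluation at the trivial coset shows that the core lies in S. *)
- move=> g h /clsP/(_ 1); rewrite !mulg1 => /idxP Sgh Sg.
  by rewrite -(mulVKg g h); exact: subgroupM.
Qed.

End FiniteIndex.

(** * The action on normal forms by right multiplication *)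

Variable rep : G -> G.
Hypothesis repP : forall g, S ((rep g)^-1 * g).
Hypothesis rep_eq : forall g h, S (g^-1 * h) -> rep g = rep h.

Lemma rep_id g : rep (rep g) = rep g.
Proof. exact: rep_eq. Qed.

(* The configuration [([:: (ck, bk); ...; (c1, b1)], g)] stands for the product
   c1 t^b1 ... ck t^bk g, with the ci taken among the coset representatives. *)
Definition nf : Type := seq (G * bool) * G.

(** The middle condition excludes pinches t^-b c t^b with c in S; the head of the list is the
    rightmost factor. *)
Fixpoint reduced (s : seq (G * bool)) : Prop :=
  if s is (c, b) :: s then
    [/\ rep c = c, (if s is (_, b1) :: _ then b1 = ~~ b -> ~ S c else True)
      & reduced s]
  else True.

Definition nf_mul (g : G) (c : nf) : nf := (c.1, c.2 * g).

(** Writing g = r x with r the representative and x in S, one has g t^b = r t^b (t^-b x t^b). *)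
Definition nf_push (b : bool) (c : nf) : nf :=
  ((rep c.2, b) :: c.1, twist (~~ b) ((rep c.2)^-1 * c.2)).

(** A pinch is removed by d t^-b g t^b = d [twist (~~ b)] g for g in S. *)
Definition nf_t (b : bool) (c : nf) : nf :=
  if c.1 is (d, b') :: s then
    if (b' == ~~ b) && `[< S c.2 >] then (s, d * twist (~~ b) c.2)
    else nf_push b c
  else nf_push b c.

Definition nf_act (c : nf) (a : option G * bool) : nf :=
  match a.1 with
  | Some g => nf_mul (letter_val id (g, a.2)) c
  | None => nf_t a.2 c
  end.

Lemma nf_t_reduced b c : reduced c.1 -> reduced (nf_t b c).1.
Proof.
case: c => -[|[d b'] s] g /=; first by rewrite rep_id.
case=> dE sd rs; rewrite /nf_t /=; case: andP => [//|nH] /=.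
split; [exact: rep_id| |by []].
move=> b'E Srep; apply: nH; rewrite b'E eqxx; split=> //; apply/asboolP.
by rewrite -[g](mulVKg (rep g)); exact: subgroupM.
Qed.

Lemma nf_act_reduced c w : reduced c.1 -> reduced (foldl nf_act c w).1.
Proof.
elim: w c => [//|[[g|] b] w IH] c rc; apply: IH => //=.
exact: nf_t_reduced.
Qed.

Lemma nf_t_conj b x c : reduced c.1 -> S x ->
  nf_t (~~ b) (nf_mul x (nf_t b c)) = nf_mul (twist b x) c.
Proof.
case: c => s g /= rs Sx.
have pushE : nf_t (~~ b) (nf_mul x (nf_push b (s, g))) =
    nf_mul (twist b x) (s, g).
  rewrite /nf_t /= !negbK eqxx asboolT; last first.
    by apply: subgroupM => //; exact: twist_sub.
  by rewrite /nf_mul /= twistM twistK !mulgA mulgV mul1g.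
rewrite {2}/nf_t /=; case: s rs pushE => [//|[d b'] s] /= [dE sd rs] pushE.
case: ifP => // /andP[/eqP b'E /asboolP Sg]; subst b'.
(* Here t^b has removed the top of the stack. The element g' x lies in the coset of d, so
   reducedness forbids a second removal, and t^-b pushes d back. *)
set g' := d * _; have Sdg' : S (d^-1 * (g' * x)).
  by rewrite /g' -!mulgA mulKg; apply: subgroupM Sx; exact: twist_sub.
have nSg' : S (g' * x) -> S d.
  move=> H; rewrite -(invgK d); apply: subgroupV.
  exact: subgroupMr H Sdg'.
have -> : nf_t (~~ b) (nf_mul x (s, g')) = nf_push (~~ b) (s, g' * x).
  rewrite /nf_t /=; case: s sd {rs pushE} => // -[d1 b1] s sd.
  case: ifP => // /andP[/eqP b1E /asboolP /nSg' Sd].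
  by case: (sd b1E).
rewrite /nf_push /nf_mul /= -(rep_eq Sdg') dE negbK /g' -!mulgA mulKg twistM.
by rewrite twistK.
Qed.

Lemma nf_tK b c : reduced c.1 -> nf_t (~~ b) (nf_t b c) = c.
Proof.
move=> rc; have := nf_t_conj b rc subgroup1.
by rewrite twist1 /nf_mul !mulg1 -!surjective_pairing.
Qed.

(** This is the uniqueness half of the normal form theorem: on reduced configurations the relators
    act trivially. *)
Lemma nf_act_pres v w : pres_eq (hnn_relators S phi) v w ->
  forall c, reduced c.1 -> foldl nf_act c v = foldl nf_act c w.
Proof.
elim=> {v w} [//|v w _ IH|u v w _ IH _ IH'|u x b v|u r v Rr] c rc.
- by rewrite IH.
- by rewrite IH // IH'.
- rewrite !foldl_cat /=; congr foldl.
  have := nf_act_reduced u rc; set d := foldl _ c u => rd.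
  case: x => [g|]; last exact: nf_tK.
  case: d {rd} => s h; rewrite /nf_act /nf_mul /letter_val /=.
  by case: b; rewrite /= -mulgA ?mulgV ?mulVg mulg1.
- rewrite !foldl_cat; congr foldl.
  have := nf_act_reduced u rc; set d := foldl _ c u => rd.
  case: Rr => [[g [h ->]]|[x Sx ->]] /=.
    case: d {rd} => s k; rewrite /nf_act /nf_mul /letter_val /=.
    by rewrite -(mulgA k) mulgK.
  rewrite /nf_act /= {1}/letter_val /= (nf_t_conj false) //.
  by case: d {rd} => s k; rewrite /nf_mul /letter_val /= mulgK.
Qed.

Local Notation H := (HNN S phi).
Local Notation pi w := (\pi_(presented (hnn_relators S phi)) w).
Definition hnn_in (g : G) : H := pi [:: (Some g, false)].
Definition hnn_t (b : bool) : H := pi [:: (None, b)].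

Lemma hnn_inM : {morph hnn_in : g h / g * h}.
Proof.
move=> g h; have /pi_rel : hnn_relators S phi
    [:: (Some g, false); (Some h, false); (Some (g * h), true)].
  by left; exists g, h.
rewrite !word_val_cons word_val_nil mulg1 /letter_val /= mulgA => /divg1_eq.
by [].
Qed.

Lemma hnn_in1 : hnn_in 1 = 1.
Proof. by apply: (mulgI (hnn_in 1)); rewrite -hnn_inM !mulg1. Qed.

Lemma hnn_inV g : hnn_in g^-1 = (hnn_in g)^-1.
Proof. by apply: (mulgI (hnn_in g)); rewrite -hnn_inM !mulgV hnn_in1. Qed.

Lemma hnn_tV b : hnn_t (~~ b) = (hnn_t b)^-1.
Proof. exact: pi_invl. Qed.

Lemma hnn_conj b x : S x ->
  hnn_t b * hnn_in x * hnn_t (~~ b) = hnn_in (twist b x).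
Proof.
have conj0 y : S y -> hnn_t false * hnn_in y * hnn_t true = hnn_in (phi y).
  move=> Sy; have /pi_rel : hnn_relators S phi
    [:: (None, false); (Some y, false); (None, true); (Some (phi y), true)].
    by right; exists y.
  rewrite !word_val_cons word_val_nil mulg1 /letter_val /= !mulgA => /divg1_eq.
  by rewrite (hnn_tV false).
case: b => Sx; last exact: conj0.
have := conj0 _ (twist_sub true Sx); rewrite /= psiK => <-.
by rewrite (hnn_tV false) !mulgA mulVg mul1g mulgVK.
Qed.

Fixpoint stack_val (s : seq (G * bool)) : H :=
  if s is (c, b) :: s then stack_val s * hnn_in c * hnn_t b else 1.

Definition nf_val (c : nf) : H := stack_val c.1 * hnn_in c.2.

Lemma nf_val_act c a : nf_val (nf_act c a) = nf_val c * pi [:: a].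
Proof.
case: c a => s g [[h|] b]; rewrite /nf_act /nf_val /=.
  rewrite hnn_inM mulgA; congr (_ * _); rewrite /letter_val /=.
  by case: b; rewrite ?hnn_inV // -(pi_invl _ _ false).
rewrite -/(hnn_t b).
have pushE : nf_val (nf_push b (s, g)) = nf_val (s, g) * hnn_t b.
  rewrite /nf_val /= -(hnn_conj _ (repP g)) negbK !mulgA (hnn_tV b) mulgK.
  by rewrite -(mulgA _ (hnn_in _) (hnn_in _)) -hnn_inM mulVKg.
rewrite /nf_t; case: s pushE => [//|[d b'] s] pushE.
case: ifP => // /andP[/eqP /= -> /asboolP Sg]; rewrite /nf_val /=.
by rewrite hnn_inM -hnn_conj // negbK !mulgA.
Qed.

Lemma nf_val_word w : nf_val (foldl nf_act ([::], 1) w) = pi w.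
Proof.
have valE c : nf_val (foldl nf_act c w) = nf_val c * pi w.
  elim: w c => [|a w IH] c; first by rewrite pi_nil mulg1.
  by rewrite /= IH nf_val_act -mulgA -(pi_cat _ [:: a]).
by rewrite valE /nf_val /= mul1g hnn_in1 mul1g.
Qed.

(** * The semidirect product with a finite cyclic group *)

Section FiniteOrder.
Variable n : nat.
Hypotheses (n_gt0 : (0 < n)%N) (phin : iter n phi =1 id).

Lemma iter_modn m g : iter (m %% n) phi g = iter m phi g.
Proof.
rewrite {2}(divn_eq m n) addnC iterD; congr iter.
by elim: (m %/ n)%N => [//|k IH]; rewrite mulSn iterD phin.
Qed.

Definition Zn_shift (b : bool) (k : 'I_n) : 'I_n :=
  if b then ord_pred k else ordS k.

Lemma Zn_shiftK b k : Zn_shift (~~ b) (Zn_shift b k) = k.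
Proof. by case: b; [exact: ord_predK|exact: ordSK]. Qed.

Lemma iter_phiM k : {morph iter k phi : x y / x * y}.
Proof. by elim: k => [//|k IH] x y /=; rewrite IH gmulfM. Qed.

Lemma iter_phi1 k : iter k phi 1 = 1.
Proof. by apply: (mulgI (iter k phi 1)); rewrite -iter_phiM !mulg1. Qed.

(* Right multiplication in the semidirect product of G by Z/n, a quotient of
   the HNN extension into which G embeds. *)
Definition sd_act (c : G * 'I_n) (a : option G * bool) : G * 'I_n :=
  match a.1 with
  | Some g => (c.1 * iter c.2 phi (letter_val id (g, a.2)), c.2)
  | None => (c.1, Zn_shift a.2 c.2)
  end.

Lemma sd_act_pres v w : pres_eq (hnn_relators S phi) v w ->
  forall c, foldl sd_act c v = foldl sd_act c w.
Proof.
elim=> {v w} [//|v w _ IH|u v w _ IH _ IH'|u x b v|u r v Rr] c.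
- by rewrite IH.
- by rewrite IH // IH'.
- rewrite !foldl_cat /=; congr foldl; case: (foldl _ c u) => h k.
  case: x => [g|]; last by rewrite /sd_act /= Zn_shiftK.
  rewrite /sd_act /letter_val /= -mulgA -iter_phiM.
  by case: b; rewrite /= ?mulgV ?mulVg iter_phi1 mulg1.
- rewrite !foldl_cat; congr foldl; case: (foldl _ c u) => h k.
  case: Rr => [[x [y ->]]|[x Sx ->]] /=; rewrite /sd_act /letter_val /=.
    by rewrite -(mulgA h) -iter_phiM -mulgA -iter_phiM mulgV iter_phi1 mulg1.
  (* After t the exponent is k+1 modulo n, so x contributes phi^(k+1)(x) = phi^k(phi(x)); t^-1
     restores the exponent k, and the last letter cancels this. *)
  rewrite ordSK iter_modn iterSr -mulgA.
  rewrite [X in iter X _ _^-1](congr1 val (ordSK k) :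
    ((k.+1 %% n + n).-1 %% n = k)%N).
  by rewrite -iter_phiM mulgV iter_phi1 mulg1.
Qed.

Lemma sd_act_mul w h k :
  (foldl sd_act (h, k) w).1 = h * (foldl sd_act (1, k) w).1.
Proof.
elim: w h k => [|[[g|] b] w IH] h k /=; first by rewrite mulg1.
  by rewrite /sd_act /= mul1g IH [in RHS]IH mulgA.
exact: IH.
Qed.

Let k0 : 'I_n := Ordinal n_gt0.

(** An empty stack means that [w] equals some g of G in the HNN-extension; the semidirect product,
    into which G embeds, then forces g = 1. [P] will be membership in the core. *)
Lemma hnn_eq1P (P : G -> Prop) w : P 1 -> pi w = 1 <->
  (foldl sd_act (1, k0) w).1 = 1 /\
  exists2 g, foldl nf_act ([::], 1) w = ([::], g) & P g.
Proof.
move=> P1; split=> [|[]].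
  rewrite -pi_nil => /presentedP w1.
  by rewrite (sd_act_pres w1) (nf_act_pres w1) //; split=> //; exists 1.
move=> /= sd1 [g wg _]; have := nf_val_word w.
rewrite wg /nf_val /= mul1g => gw; rewrite -gw.
move/esym/presentedP/sd_act_pres: gw => /(_ (1, k0)) gw.
by move: sd1; rewrite gw /= mul1g /letter_val /= => ->; rewrite hnn_in1.
Qed.

Section Gsm.
Variables (X : finType) (gen : X -> G) (wd : G -> word X) (x0 : X).
Hypothesis wdK : forall g, word_val gen (wd g) = g.
Local Notation letter := (option X * bool)%type.

Definition sd_delta (k : 'I_n) (a : letter) : 'I_n :=
  if a.1 is Some _ then k else Zn_shift a.2 k.

(* The trailing [x0 x0^-1] makes all outputs nonempty. *)
Definition sd_out (k : 'I_n) (a : letter) : word X :=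
  (if a.1 is Some x then wd (iter k phi (letter_val gen (x, a.2))) else [::])
  ++ [:: (x0, false); (x0, true)].

Lemma sd_out_neq0 k a : sd_out k a != [::].
Proof. by rewrite -size_eq0 size_cat addnS. Qed.

(** The state is the exponent of t reached so far, modulo n; each letter of G is output with that
    power of [phi] applied. *)
Lemma sd_gsm k w : word_val gen (gsm sd_delta sd_out k w) =
  (foldl sd_act (1, k) (map (to_hnn gen) w)).1.
Proof.
elim: w k => [|[[x|] b] w IH] k /=; first exact: word_val_nil.
  rewrite word_val_cat IH word_val_cat wdK !word_val_cons word_val_nil.
  by rewrite /sd_act /= mul1g mulg1 mulgV mulg1 [RHS]sd_act_mul.
by rewrite !word_val_cons IH /letter_val /= mulVKg.
Qed.

End Gsm.

End FiniteOrder.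
(** * The HNN-extension modulo the core of S *)

Section FiniteQuotient.
Variables (X : finType) (gen : X -> G).
Variables (Q : finType) (cls : G -> Q) (sec : Q -> G).
Hypothesis clsK : forall g, cls (sec (cls g)) = cls g.
Hypothesis clsM : forall g g' h h',
  cls g = cls g' -> cls h = cls h' -> cls (g * h) = cls (g' * h').
Hypothesis cls_twist : forall b g h,
  cls g = cls h -> cls (twist b g) = cls (twist b h).
Hypothesis cls_sub : forall g h, cls g = cls h -> S g -> S h.

Local Notation letter := (option X * bool)%type.
Local Notation to_hnn := (to_hnn gen).

Definition base_language : language letter :=
  [set w | exists2 g, foldl nf_act ([::], 1) (map to_hnn w) = ([::], g) &
           cls g = cls 1].

Lemma cls_rep g h : cls g = cls h -> rep g = rep h.
Proof.
move=> gh; apply: rep_eq; have := @clsM g^-1 g^-1 g h erefl gh.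
by rewrite mulVg => /cls_sub; apply; exact: subgroup1.
Qed.

(* The boolean in the state, and in the stack symbols, records whether the
   stack (resp. the part of the stack below the symbol) encodes [[::]]. *)
Definition base_push (b : bool) (p : Q * bool) (Z : option (Q * bool * bool)) :
    (Q * bool) * seq (option (Q * bool * bool)) :=
  let g := sec p.1 in
  ((cls (twist (~~ b) ((rep g)^-1 * g)), false),
   [:: Some (cls (rep g), b, p.2); Z]).

Definition base_trans (p : Q * bool) (o : option letter)
    (Z : option (Q * bool * bool)) :
    option ((Q * bool) * seq (option (Q * bool * bool))) :=
  match o with
  | None => None
  | Some (Some x, b) =>
      Some ((cls (sec p.1 * letter_val gen (x, b)), p.2), [:: Z])
  | Some (None, b) =>
      if Z is Some (d, b', e) then
        if (b' == ~~ b) && `[< S (sec p.1) >]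
        then Some ((cls (sec d * twist (~~ b) (sec p.1)), e), [::])
        else Some (base_push b p Z)
      else Some (base_push b p Z)
  end.

Lemma base_trans_det p Z : base_trans p None Z != None ->
  forall a, base_trans p (Some a) Z = None.
Proof. by []. Qed.

Definition base_dpda : dpda letter := @Dpda letter (Q * bool)%type
  (option (Q * bool * bool)) (cls 1, true) None [set (cls 1, true)]%SET
  base_trans base_trans_det.

Fixpoint enc_stack (s : seq (G * bool)) : seq (option (Q * bool * bool)) :=
  if s is (c, b) :: s then Some (cls c, b, nilp s) :: enc_stack s
  else [:: None].

Definition enc (c : nf) (w : seq letter) : dpda_config base_dpda :=
  ((cls c.2, nilp c.1), w, enc_stack c.1).

Lemma base_push_enc b s g w Z st : enc_stack s = Z :: st ->
  exists p r, base_push b (cls g, nilp s) Z = (p, r) /\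
    (p, w, r ++ st) = enc (nf_push b (s, g)) w.
Proof.
move=> sE; eexists; eexists; split; first by [].
rewrite /enc /= sE (cls_rep (clsK g)); congr (_, _, _, _).
by apply: cls_twist; apply: clsM => //; exact: clsK.
Qed.

(** Products, twists, representatives and membership in S depend on classes only, so the automaton
    can follow the normal form through its encoding. *)
Lemma base_dpda_trans c a w : exists Z st p r,
  [/\ enc_stack c.1 = Z :: st,
      base_trans (cls c.2, nilp c.1) (Some a) Z = Some (p, r) &
      (p, w, r ++ st) = enc (nf_act c (to_hnn a)) w].
Proof.
case: c => s g; have [Z [st sE]] : exists Z st, enc_stack s = Z :: st.
  by case: s => [|[c b] s] /=; eexists; eexists.
exists Z, st; case: a => [[x|] b] /=.
  exists (cls (sec (cls g) * letter_val gen (x, b)), nilp s), [:: Z].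
  by split=> //; rewrite /enc /= sE; congr (_, _, _, _); exact: clsM.
have pushE := base_push_enc b g w sE.
rewrite /nf_act /nf_t /=; case: s sE pushE => [|[d b'] s] /= [<- <-] pushE.
  by have [p [r [pE rE]]] := pushE; exists p, r; rewrite -pE.
have <- : `[< S (sec (cls g)) >] = `[< S g >].
  by apply/asbool_equiv_eq; split; apply: cls_sub; rewrite clsK.
case: ifP => _.
  exists (cls (sec (cls d) * twist (~~ b) (sec (cls g))), nilp s), [::].
  split=> //; congr (_, _, _, _); apply: clsM; first exact: clsK.
  by apply: cls_twist; exact: clsK.
by have [p [r [pE rE]]] := pushE; exists p, r; rewrite -pE.
Qed.

Lemma base_dpda_step c a w d :
  dpda_step (enc c (a :: w)) d <-> d = enc (nf_act c (to_hnn a)) w.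
Proof.
have [Z [st [p [r [sE tE <-]]]]] := base_dpda_trans c a w.
rewrite /enc sE; split=> [H|->]; last exact: DpdaRead.
inversion H as [q a' w' Z' s' p' r' tE'|q w' Z' s' p' r' tE']; subst => //.
by have [-> ->] : Some (p', r') = Some (p, r) by rewrite -tE' -tE.
Qed.

(** Every step reads exactly one letter and none is ever blocked, so the run that exhausts the input
    is unique. *)
Lemma base_dpda_run c w f s :
  clos_refl_trans _ (@dpda_step _ base_dpda) (enc c w) (f, [::], s) <->
  (f, [::], s) = enc (foldl nf_act c (map to_hnn w)) [::].
Proof.
elim: w c => [|a w IH] c /=.
  split=> [H|->]; last exact: rt_refl.
  have H' := clos_rt_rt1n _ _ _ _ H.
  inversion H' as [|y z xy _]; subst => //; inversion xy => //.
split=> [H|/IH]; last first.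
  by apply: rt_trans; apply: rt_step; apply/base_dpda_step.
have H' := clos_rt_rt1n _ _ _ _ H.
inversion H' as [|y z xy yz]; subst.
have yE := (base_dpda_step _ _ _ _).1 xy; subst.
by apply/IH; exact: clos_rt1n_rt.
Qed.

Lemma base_det_context_free : det_context_free base_language.
Proof.
exists base_dpda; apply/seteqP; split=> w.
  case=> g wE gE; exists (cls 1, true), [:: None]; split; first exact: set11.
  by apply/(base_dpda_run ([::], 1)); rewrite wE /enc gE.
case=> f [s [/set1P -> /(base_dpda_run ([::], 1))]]; rewrite /base_language /=.
by case: foldl => -[|//] g [gE _]; exists g.
Qed.

(** * A context-free grammar for the same language *)

Definition base_cfg : cfg letter := @Cfg letter Q (cls 1)
  ((cls 1, [::]) ::
   [seq (cls (sec p * sec q), [:: inl p; inl q]) | p <- enum Q, q <- enum Q] ++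
   [seq (cls (letter_val gen a), [:: inr (Some a.1, a.2)])
     | a <- enum {: X * bool}] ++
   [seq (cls (twist b (sec q)), [:: inr (None, b); inl q; inr (None, ~~ b)])
     | b <- enum {: bool}, q <- [seq q <- enum Q | `[< S (sec q) >]]]).

(** These turn out to be the words whose element of the HNN-extension comes from an element of G of
    class [q]. *)
Definition gens (q : Q) (w : seq letter) : Prop :=
  @yields _ base_cfg [:: inl q] w.

Lemma gens1 : gens (cls 1) [::].
Proof. by apply: yields1 (yields_nil _); rewrite inE eqxx. Qed.

Lemma gensM g h u v :
  gens (cls g) u -> gens (cls h) v -> gens (cls (g * h)) (u ++ v).
Proof.
move=> gu hv.
apply: (@yields1 _ base_cfg _ [:: inl (cls g); inl (cls h)]); last first.
  exact: yields_cat gu hv.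
rewrite inE mem_cat; apply/orP; right; apply/orP; left.
apply/allpairsP; exists (cls g, cls h); rewrite !mem_enum; split=> //=.
by congr (_, _); apply: clsM; rewrite clsK.
Qed.

Lemma gens_letter a : gens (cls (letter_val gen a)) [:: (Some a.1, a.2)].
Proof.
apply: yields1 (yields_letter _ (yields_nil _)).
rewrite inE !mem_cat; apply/orP; right; apply/orP; right; apply/orP; left.
by apply/mapP; exists a; rewrite ?mem_enum.
Qed.

Lemma gens_twist b g w : S g -> gens (cls g) w ->
  gens (cls (twist b g)) ((None, b) :: w ++ [:: (None, ~~ b)]).
Proof.
move=> Sg gw.
apply: (@yields1 _ base_cfg _
  [:: inr (None, b); inl (cls g); inr (None, ~~ b)]).
  rewrite inE !mem_cat; do 3 (apply/orP; right).
  apply/allpairsP; exists (b, cls g); split=> /=; first by rewrite mem_enum.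
    rewrite mem_filter mem_enum andbT; apply/asboolP.
    by apply: cls_sub Sg; rewrite clsK.
  by congr (_, _); apply: cls_twist; rewrite clsK.
apply: yields_letter; apply: (yields_cat gw).
exact: yields_letter (yields_nil _).
Qed.

(** The letters t^b still on the stack cut [w] into blocks generated by the grammar. The value
    before such a letter is c x with x in S, and x is carried across it as [twist (~~ b) x]. *)
Fixpoint parsed (s : seq (G * bool)) (g : G) (w : seq letter) : Prop :=
  if s is (c, b) :: s then
    exists x h u v, [/\ S x, g = twist (~~ b) x * h, w = u ++ (None, b) :: v,
      parsed s (c * x) u & gens (cls h) v]
  else gens (cls g) w.

Lemma parsedM s g w h v :
  parsed s g w -> gens (cls h) v -> parsed s (g * h) (w ++ v).
Proof.
case: s => [|[c b] s] /=; first exact: gensM.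
case=> x [g' [u [v' [Sx -> -> su gv]]]] hv.
exists x, (g' * h), u, (v' ++ v); split; rewrite ?mulgA -?catA //.
exact: gensM.
Qed.

Lemma parsed_act c a w : parsed c.1 c.2 w ->
  parsed (nf_act c (to_hnn a)).1 (nf_act c (to_hnn a)).2 (w ++ [:: a]).
Proof.
case: c => s g /=; case: a => [[x|] b] sw.
  exact: parsedM sw (gens_letter (x, b)).
rewrite /nf_act /=.
have pushP : parsed (nf_push b (s, g)).1 (nf_push b (s, g)).2
    (w ++ [:: (None, b)]).
  exists ((rep g)^-1 * g), 1, w, [::]; rewrite mulg1 mulVKg.
  by split=> //; exact: gens1.
rewrite /nf_t /=; case: s sw pushP => [//|[d b'] s] sw pushP.
case: andP => // -[/eqP b'E /asboolP Sg] /=; subst b'; rewrite /= in sw.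
have [x [h [u [v [Sx gE -> su hv]]]]] := sw.
(* A pinch closes: both g and the twisted x lie in S, hence so does h, and a conjugation production
   generates the last block with its two enclosing letters. *)
have Sh : S h.
  rewrite -(mulKg (twist (~~ ~~ b) x) h) -gE; apply: subgroupM => //.
  by apply/subgroupV/twist_sub.
have := parsedM su (gens_twist (~~ b) Sh hv).
rewrite -catA negbK /= gE twistM (_ : twist (~~ b) (twist (~~ ~~ b) x) = x).
  by rewrite mulgA.
exact: twistK.
Qed.

Lemma base_complete w g :
  foldl nf_act ([::], 1) (map to_hnn w) = ([::], g) -> gens (cls g) w.
Proof.
suff: parsed (foldl nf_act ([::], 1) (map to_hnn w)).1
    (foldl nf_act ([::], 1) (map to_hnn w)).2 w.
  by move=> + wE; rewrite wE.
elim/last_ind: w => [|w a IH]; first exact: gens1.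
by rewrite map_rcons foldl_rcons -cats1; exact: parsed_act.
Qed.

(** A variable may take the value of any element of its class, so a sentential form has several
    values. *)
Fixpoint denotes (r : seq (Q + letter)) (h : H) : Prop :=
  match r with
  | [::] => h = 1
  | inl q :: r => exists g h', [/\ cls g = q, h = hnn_in g * h' & denotes r h']
  | inr a :: r => exists2 h', h = pi [:: to_hnn a] * h' & denotes r h'
  end.

Lemma base_prods_sound q r h : (q, r) \in cfg_prods base_cfg -> denotes r h ->
  exists2 g, cls g = q & h = hnn_in g.
Proof.
rewrite inE !mem_cat => /orP[/eqP[-> ->] ->|/orP[|/orP[]]].
- by exists 1; rewrite ?hnn_in1.
- case/allpairsP=> -[p p'] /= [_ _ [-> ->]].
  case=> g [_ [gE -> [g' [_ [g'E -> ->]]]]].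
  exists (g * g'); last by rewrite hnn_inM mulg1.
  by rewrite -gE -g'E; apply: clsM; rewrite clsK.
- case/mapP=> -[x b] _ [-> ->] /= [_ -> ->].
  exists (letter_val gen (x, b)) => //; rewrite mulg1 /letter_val /=.
  by case: b; rewrite // hnn_inV -(pi_invl _ _ false).
- case/allpairsP=> -[b p] /= [_ + [-> ->]]; rewrite mem_filter.
  case/andP=> /asboolP Sp _ [_ -> [g [_ [gE -> [_ -> ->]]]]].
  have Sg : S g by apply: cls_sub Sp; rewrite -gE clsK.
  exists (twist b g); last by rewrite -hnn_conj // mulg1 mulgA.
  by apply: cls_twist; rewrite -gE clsK.
Qed.

Lemma gens_sound q w : gens q w ->
  exists2 g, cls g = q & pi (map to_hnn w) = hnn_in g.
Proof.
suff Hden r : @yields _ base_cfg r w -> denotes r (pi (map to_hnn w)).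
  move/Hden=> /= [g [_ [gE -> ->]]]; exists g; by rewrite ?mulg1.
elim=> {w r} [//|a r w _ IH|q' body r u v inP _ IHu _ IHv] /=.
  by exists (pi (map to_hnn w)) => //; rewrite -(pi_cat _ [:: _]).
have [g gE uE] := base_prods_sound inP IHu.
by exists g, (pi (map to_hnn v)); rewrite map_cat pi_cat uE.
Qed.

Lemma base_context_free : context_free base_language.
Proof.
exists base_cfg; apply/seteqP; split=> w.
  case=> g /base_complete gw gE; apply/cfg_languageP; move: gw.
  by rewrite gE.
move/cfg_languageP/gens_sound=> [g gE wE]; exists g => //.
(* As [w] equals the one-letter word g in the HNN-extension, both have the same normal form. *)
move/presentedP/nf_act_pres: wE => -> //.
by rewrite /= /nf_act /nf_mul /letter_val /= mul1g.
Qed.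

End FiniteQuotient.
(** * The word problem *)

Section Generators.
Variables (X : finType) (gen : X -> G).
Hypothesis gen_surj : forall g, exists w, word_val gen w = g.

Definition hnn_gen (o : option X) : H := pi [:: (omap gen o, false)].

Lemma hnn_genE w : word_val hnn_gen w = pi (map (to_hnn gen) w).
Proof.
by rewrite pi_word_val (word_val_map (fun o => pi [:: (o, false)]) (omap gen)).
Qed.

Lemma hnn_gen_surj h : exists w, word_val hnn_gen w = h.
Proof.
rewrite -[h]reprK; elim: (repr h) => [|a w [w' w'E]].
  by exists [::]; rewrite word_val_nil.
suff [v vE] : exists v, word_val hnn_gen v = pi [:: a].
  by exists (v ++ w'); rewrite word_val_cat vE w'E -pi_cat.
case: a => [[g|] b]; last by exists [:: (None, b)]; rewrite hnn_genE.
have [v vE] := gen_surj (letter_val id (g, b)).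
exists [seq (Some a.1, a.2) | a <- v]; rewrite word_val_map.
have -> : word_val (hnn_gen \o Some) v = hnn_in (word_val gen v).
  elim: {vE} v => [|[x c] v IH]; first by rewrite !word_val_nil hnn_in1.
  rewrite !word_val_cons hnn_inM -IH; congr (_ * _).
  by case: c; rewrite /letter_val //= hnn_inV.
rewrite vE /letter_val; case: b {vE} => //=.
by rewrite hnn_inV -(pi_invl _ _ false).
Qed.

End Generators.
End NormalForms.

(** Both classes are treated at once. The base language is deterministic context-free and
    context-free: the first fact serves [BDC], the second [PCF]. *)
Lemma hnn_word_problem_class (C : forall T : finType, language T -> Prop)
    (G : groupType) (S : set G) (phi : {multiplicative G -> G}) :
  (forall (T T' K : finType) (delta : K -> T' -> K) (out : K -> T' -> seq T),
     (forall k x, out k x != [::]) -> forall k (L : language T),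
     C T L -> C T' [set w | L (gsm delta out k w)]) ->
  (forall (T : finType) (L L' : language T),
     C T L -> C T L' -> C T (L `&` L')) ->
  (forall (T : finType) (L : language T),
     det_context_free L -> context_free L -> C T L) ->
  group_closed [in S] -> finite_index S -> bijective phi -> finite_order phi ->
  (phi @` S)%classic = S ->
  fg_group_with_WP C G -> fg_group_with_WP C (HNN S phi).
Proof.
move=> C_gsm C_inter C_base Sg Sfin [psi phiK psiK] [n [n_gt0 phin]] phiS.
case/fg_group_generators=> X [gen [gen_surj C_gen]].
have [rep [repP rep_eq]] := coset_representatives Sg Sfin.
have [Q [cls [sec [clsK clsM cls_twist cls_sub]]]] :=
  finite_quotient Sg phiK psiK phiS Sfin.
have [iso wpE] := kernel_presentation
  (hnn_gen_surj (S := S) (phi := phi) gen_surj).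
exists (option X), [set w | word_val (hnn_gen S phi gen) w = 1].
split=> //; rewrite {}wpE.
pose base := base_language S phi psi rep gen cls.
have C_base_language : C _ base by apply: C_base;
  [exact: base_det_context_free clsM cls_twist cls_sub
  |exact: base_context_free clsM cls_twist cls_sub].
have eq1P w : word_val (hnn_gen S phi gen) w = 1 <->
    (foldl (@sd_act G phi n) (1, Ordinal n_gt0) (map (to_hnn gen) w)).1 = 1 /\
    base w.
  by rewrite hnn_genE; exact: hnn_eq1P.
(* The padding in [sd_out] takes a generator [x0]; without generators G is trivial and the base
   language alone is the word problem. *)
have [x0 _|X0] := pickP X.
  pose wd g := sval (cid (gen_surj g)).
  have wdK g : word_val gen (wd g) = g by rewrite /wd; case: cid.
  have -> : [set w | word_val (hnn_gen S phi gen) w = 1] = base `&`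
      [set w | [set v | word_val gen v = 1]
        (gsm (@sd_delta n X) (sd_out phi gen wd x0) (Ordinal n_gt0) w)].
    apply/seteqP; split=> w /=.
      by move/eq1P=> [w1 wbase]; rewrite sd_gsm.
    by case=> wbase; rewrite sd_gsm // => w1; apply/eq1P.
  by apply: C_inter => //; apply: C_gsm C_gen; exact: sd_out_neq0.
have G1 (g : G) : g = 1.
  by have [[|[x b] w] <-] := gen_surj g; [exact: word_val_nil|have := X0 x].
suff -> : [set w | word_val (hnn_gen S phi gen) w = 1] = base by [].
apply/seteqP; split=> w /=; first by case/eq1P.
by move=> wbase; apply/eq1P; split=> //; exact: G1.
Qed.

Theorem theorem4p1 (G : groupType) (S : set G) (phi : {multiplicative G -> G})
    (S_subgroup : group_closed [in S]) (S_index : finite_index S)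
    (phi_aut : bijective phi) (phi_order : finite_order phi)
    (phi_S : (phi @` S)%classic = S) :
  (BDG G -> BDG (HNN S phi)) /\ (PG G -> PG (HNN S phi)).
Proof.
split; apply: hnn_word_problem_class => //.
- by move=> *; exact: BDC_gsm.
- by move=> *; exact: BDC_inter.
- by move=> *; exact: BDC_dcf.
- by move=> *; exact: PCF_gsm.
- by move=> *; exact: PCF_inter.
- by move=> *; exact: context_free_PCF.
Qed.
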